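(* Let $u$ be a convex function on an open convex set $\Omega\subset\mathbb{R}^2$. Then for every $x\in\Omega$, \[ |\partial u(x)| = \int_0^{2\pi}\frac12\left(R_+(x,\theta)^2-R_-(x,\theta)^2\right)^+\,d\theta, \] where \[ R_+(x,\theta)=\inf_{\theta'\in(\theta-\frac\pi2,\theta+\frac\pi2)}\frac{(\partial_{\theta'}u(x))^+}{\cos(\theta-\theta')},\qquad R_-(x,\theta)=\sup_{\theta'\in(\theta-\frac\pi2,\theta+\frac\pi2)}\frac{(-\partial_{\theta'+\pi}u(x))^+}{\cos(\theta-\theta')}. \]
   Context: $|\cdot|$ denotes Lebesgue measure on $\mathbb{R}^2$; $\partial u(x)=\{p\in\mathbb{R}^2: u(z)\ge u(x)+p\cdot(z-x)\ \forall z\in\Omega\}$ is the subgradient. For $\theta\in\mathbb{R}$, $e_\theta=(\cos\theta,\sin\theta)$ and $\partial_\theta u(x)=\lim_{r\to0^+}\frac{u(x+re_\theta)-u(x)}{r}$ is the one-sided directional derivative. For real $a$, $a^+=\max\{a,0\}$. *)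

(* Defs.v *)
From mathcomp Require Import all_boot all_order all_algebra.
From mathcomp Require Import all_classical all_reals all_analysis.
Set Implicit Arguments. Unset Strict Implicit. Unset Printing Implicit Defensive.
Import Order.TTheory GRing.Theory Num.Theory.
Import numFieldNormedType.Exports.
Local Open Scope classical_set_scope.
Local Open Scope ring_scope.

Section Defs.
Variable R : realType.

Definition dot2 (p q : R * R) : R := p.1 * q.1 + p.2 * q.2.

Definition convex_set2 (O : set (R * R)) : Prop :=
  forall a b : R * R, O a -> O b -> forall t : R, 0 <= t -> t <= 1 ->
    O ((1 - t) * a.1 + t * b.1, (1 - t) * a.2 + t * b.2).

Definition convex_on2 (O : set (R * R)) (u : R * R -> R) : Prop :=
  forall a b : R * R, O a -> O b -> forall t : R, 0 <= t -> t <= 1 ->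
    u ((1 - t) * a.1 + t * b.1, (1 - t) * a.2 + t * b.2)
      <= (1 - t) * u a + t * u b.

Definition subgrad (O : set (R * R)) (u : R * R -> R) (x : R * R)
  : set (R * R) :=
  [set p | forall z, O z -> u x + dot2 p (z.1 - x.1, z.2 - x.2) <= u z].

Definition etheta (th : R) : R * R := (cos th, sin th).

Definition dirder (u : R * R -> R) (x : R * R) (th : R) : R :=
  lim ((fun r : R => (u (x.1 + r * cos th, x.2 + r * sin th) - u x) / r)
         @ 0^'+).

Definition Rplus (u : R * R -> R) (x : R * R) (th : R) : \bar R :=
  ereal_inf [set ((Num.max (dirder u x th') 0) / cos (th - th'))%:E
            | th' in `](th - pi / 2), (th + pi / 2)[ ].

Definition Rminus (u : R * R -> R) (x : R * R) (th : R) : \bar R :=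
  ereal_sup [set ((Num.max (- dirder u x (th' + pi)) 0) / cos (th - th'))%:E
            | th' in `](th - pi / 2), (th + pi / 2)[ ].

(* integrand  1/2 (R_+^2 - R_-^2)^+  (extended-real valued; R_- may be +oo) *)
Definition area_integrand (u : R * R -> R) (x : R * R) (th : R) : \bar R :=
  ((2^-1)%:E * maxe (Rplus u x th * Rplus u x th - Rminus u x th * Rminus u x th) 0)%E.

End Defs.

(* Main.v *)
Require Import Defs.
From HB Require Import structures.
From mathcomp Require Import all_boot all_order all_algebra.
From mathcomp Require Import all_classical all_reals all_analysis.
From mathcomp Require Import measurable_realfun ring lra.
Set Implicit Arguments. Unset Strict Implicit. Unset Printing Implicit Defensive.
Import Order.TTheory GRing.Theory Num.Theory.
Import numFieldNormedType.Exports.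
Local Open Scope classical_set_scope.
Local Open Scope ring_scope.

(** In polar coordinates [p = r e_th] with [r > 0], the subgradient is the set of
    [p] with [r cos (th - phi) <= h phi] for every angle [phi], where [h] is the
    one-sided directional derivative.  The angles [phi] with
    [cos (th - phi) > 0] give [r <= R_+], those with [cos (th - phi) < 0] give
    [R_- <= r], and the two angles orthogonal to [th] give nothing new because
    [h] is sublinear.  Hence each ray meets the subgradient in the segment
    [[R_-, R_+]], and integrating [r dr] over it yields the integrand.
    The polar area formula itself comes from Tonelli's theorem on the upper and
    lower half-planes: substitute [x = - y t] at height [y], then
    [y = r cos (atan t)], and finally [th = pi / 2 + atan t]. *)

(** * Integration on the line: restriction, scaling, densities and the arctangent substitution *)

Lemma integral_mrestr d (T : measurableType d) (R : realType)
    (mu : {measure set T -> \bar R}) (D : set T) (mD : measurable D)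
    (f : T -> \bar R) :
  measurable_fun [set: T] f -> (forall x, 0 <= f x)%E ->
  (\int[mrestr mu mD]_x f x = \int[mu]_(x in D) f x)%E.
Proof.
move=> mf f0.
rewrite -(setUv D) ge0_integral_setU //=; last 3 first.
- exact: measurableC.
- by rewrite setUv.
- exact/disj_setPCl.
rewrite [X in (_ + X)%E](_ : _ = 0)%E ?adde0.
  apply: eq_measure_integral => A mA AD /=.
  by rewrite /mrestr setIidl.
(* Off [D] the restricted measure coincides with the zero measure. *)
rewrite -(@integral_measure_zero _ T R (~` D) f).
apply: eq_measure_integral => A mA AD /=.
rewrite /mrestr (_ : A `&` D = set0) ?measure0 //.
by apply/disjoints_subset.
Qed.

(* The measurability proof of [phi] cannot be inferred, so the canonical measure
   structure of [pushforward mu phi] is named explicitly. *)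
Definition image_measure d1 d2 (X : measurableType d1) (Y : measurableType d2)
    (R : realType) (mu : {measure set X -> \bar R}) (phi : X -> Y)
    (mphi : measurable_fun [set: X] phi) : {measure set Y -> \bar R} :=
  @measure_function_pushforward__canonical__measure_function_Measure
    _ _ _ _ _ mu phi mphi.

Section scaling.
Context {R : realType}.
Local Notation mu := (@lebesgue_measure R).

(** Lebesgue measure equals [|k|] times its push-forward by multiplication by [k]: the two agree on
    the intervals []a, b]], hence everywhere by uniqueness. *)
Lemma ge0_integral_scale (k : R) (g : R -> \bar R) : k != 0 ->
  measurable_fun [set: R] g -> (forall x, 0 <= g x)%E ->
  (\int[mu]_x g x = `|k|%:E * \int[mu]_x g (k * x)%R)%E.
Proof.
move=> k0 mg g0.
have mk : measurable_fun [set: measurableTypeR R] ( *%R k : measurableTypeR R -> measurableTypeR R).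
  exact: measurable_funM.
pose nu : {measure set (measurableTypeR R) -> \bar R} :=
  mscale (NngNum (normr_ge0 k)) (image_measure mu mk).
have E : forall A, measurable A -> mu A = nu A.
  apply: lebesgue_measure_unique => X /ocitvP[->|[[a b] /= ab ->]].
    by rewrite !measure0.
  rewrite /nu /mscale/= /pushforward.
  have [kn|kp] := ltrP k 0.
    (* A negative factor reverses the interval, so the closed end moves to the left; the length is
       unaffected. *)
    rewrite (_ : _ @^-1` _ = `[b / k, a / k[%classic); last first.
      apply/seteqP; split => y /=; rewrite !in_itv/= ler_ndivrMr// ltr_ndivlMr// ![y * k]mulrC.
      by rewrite andbC.
      by rewrite andbC.
    rewrite !lebesgue_measure_itv/= !lte_fin ab ltr_nM2r ?invr_lt0// ab.
    rewrite ltr0_norm// -!EFinD -EFinM; congr EFin; field.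
    exact: k0.
  have {}kp : 0 < k by rewrite lt_neqAle eq_sym k0.
  rewrite (_ : _ @^-1` _ = `]a / k, b / k]%classic); last first.
    by apply/seteqP; split => y /=; rewrite !in_itv/= ler_pdivlMr// ltr_pdivrMr// ![y * k]mulrC.
  rewrite !lebesgue_measure_itv/= !lte_fin ab ltr_pM2r ?invr_gt0// ab.
  rewrite gtr0_norm// -!EFinD -EFinM; congr EFin; field.
  exact: k0.
rewrite (@eq_measure_integral _ (measurableTypeR R) R setT nu mu); last by move=> A mA _; exact: E.
rewrite ge0_integral_mscale//=.
rewrite (ge0_integral_pushforward mk)//.
Qed.
End scaling.

(* [nu] is the projection of the product measure restricted to the region under
   the graph of [w]; Tonelli's theorem then gives the integrals against [nu]. *)
Lemma ge0_integral_density d (T : measurableType d) (R : realType)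
    (mu : {sigma_finite_measure set T -> \bar R}) (w : T -> R) :
  measurable_fun [set: T] w -> (forall x, 0 <= w x) ->
  exists2 nu : {measure set T -> \bar R},
    (forall A, measurable A -> nu A = \int[mu]_(x in A) (w x)%:E)%E &
    forall f : T -> \bar R, measurable_fun [set: T] f ->
      (forall x, 0 <= f x)%E -> (\int[nu]_x f x = \int[mu]_x ((w x)%:E * f x))%E.
Proof.
move=> mw w0.
pose lam := @lebesgue_measure R.
pose P := [set z : T * measurableTypeR R | 0 <= z.2 < w z.1].
have mP : measurable P.
  have -> : P = (fun z : T * measurableTypeR R => (0 : R) <= z.2) @^-1` [set true]
     `&` (fun z : T * measurableTypeR R => (z.2 : R) < w z.1) @^-1` [set true].
    by apply/seteqP; split => z /=; rewrite /P /=; [move=> /andP[]|move=> [-> ->]].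
  apply: measurableI; rewrite -[X in measurable X]setTI.
  - by apply: measurable_fun_ler => //; exact: measurable_snd.
  - by apply: measurable_fun_ltr => //; exact: measurableT_comp.
have xP x : xsection P x = `[0, w x[%classic.
  by apply/seteqP; split => s; rewrite /xsection/= /P inE/= in_itv.
have lamw x : lam `[0, w x[%classic = (w x)%:E.
  rewrite /lam lebesgue_measure_itv/= lte_fin.
  by case: ltP => [_|wx0]; rewrite ?sube0//; congr EFin; apply/eqP; rewrite eq_le w0.
pose M := (mu \x lam)%E.
have mfst : measurable_fun [set: T * measurableTypeR R] (@fst T (measurableTypeR R)).
  exact: measurable_fst.
exists (image_measure (mrestr M mP) mfst) => [A mA|f mf f0].
  rewrite /image_measure/= /pushforward /mrestr /M /product_measure1.
  rewrite [RHS]integral_mkcond; apply: eq_integral => x _ /=.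
  rewrite patchE; case: ifPn => [xA|xA].
    rewrite (_ : xsection _ x = xsection P x).
      by rewrite xP; exact: lamw.
    move: xA; rewrite inE => Ax.
    by apply/seteqP; split => s; rewrite /xsection/= !inE/=; [case|split].
  rewrite (_ : xsection _ x = set0) ?measure0//.
  apply/seteqP; split => s //; rewrite /xsection/= !inE/= => -[Ax _].
  by move: xA; rewrite notin_setE.
rewrite (ge0_integral_pushforward mfst)//.
rewrite preimage_setT integral_mrestr; last 2 first.
- exact: (measurableT_comp mf mfst).
- by move=> z; exact: f0.
rewrite integral_mkcond fubini_tonelli1; last 2 first.
- apply/(measurable_restrictT _ mP); exact: measurable_funTS (measurableT_comp mf mfst).
- by move=> z; rewrite patchE; case: ifPn => _ /=.
apply: eq_integral => x _; rewrite /fubini_F.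
transitivity (\int[lam]_(y in `[0%R, w x[) f x)%E.
  rewrite [RHS]integral_mkcond; apply: eq_integral => y _.
  by rewrite !patchE/= -xP mem_xsection.
by rewrite integral_cst// muleC; congr (_ * _)%E; exact: lamw.
Qed.

Section arctan.
Context {R : realType}.

Let atan_nd : nondecreasing (@atan R).
Proof. by move=> x y; exact: le_atan. Qed.

Let atan_rc : right_continuous (@atan R).
Proof. by move=> x; apply/right_continuousW; exact: continuous_atan. Qed.

HB.instance Definition _ := isCumulative.Build R _ R (@atan R) atan_nd atan_rc.

Lemma stieltjes_atan (a b : R) : a <= b ->
  lebesgue_stieltjes_measure (@atan R) `]a, b]%classic = (atan b - atan a)%:E.
Proof.
move=> ab; rewrite /lebesgue_stieltjes_measure /measure_extension measurable_mu_extE/=.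
  by rewrite wlength_itv_bnd.
exact: is_ocitv.
Qed.
End arctan.

(* The image of Lebesgue measure by [tan (. - c)] and the measure of density
   [1 / (1 + t ^ 2)] are both the Stieltjes measure of [atan]. *)
Lemma ge0_integral_atan (R : realType) (c : R) (G : R -> \bar R) :
  measurable_fun [set: R] G -> (forall x, 0 <= G x)%E ->
  (\int[@lebesgue_measure R]_(x in `](c - pi / 2)%R, (c + pi / 2)%R[) G x =
   \int[@lebesgue_measure R]_t (((1 + t ^+ 2)^-1)%:E * G (c + atan t)%R))%E.
Proof.
move=> mG G0.
pose mu := @lebesgue_measure R.
pose I : set (measurableTypeR R) := `](c - pi / 2), (c + pi / 2)[%classic.
have mI : measurable I by exact: measurable_itv.
have cw : continuous (fun t : R => (1 + t ^+ 2)^-1).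
  move=> t; apply: cvgV; first by rewrite gt_eqF// ltr_pwDl// sqr_ge0.
  apply: cvgD; first exact: cvg_cst.
  exact: exprn_continuous.
have mw : measurable_fun [set: measurableTypeR R] (fun t : R => (1 + t ^+ 2)^-1).
  apply: (@continuous_measurable_fun R) => t.
  exact: cw.
have w0 (t : R) : 0 <= (1 + t ^+ 2)^-1 by rewrite invr_ge0 addr_ge0// sqr_ge0.
have [nu nuE nuI] := @ge0_integral_density _ _ R mu _ mw w0.
(* Extension by 0 off [I] makes [psi] measurable on the whole line, as a push-forward requires; the
   measure pushed forward is [mu] restricted to [I]. *)
pose psi : measurableTypeR R -> measurableTypeR R := (fun x => tan (x - c)) \_ I.
have mpsi : measurable_fun [set: measurableTypeR R] psi.
  apply/(measurable_restrictT _ mI).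
  apply: open_continuous_measurable_fun; first exact: interval_open.
  move=> x; rewrite inE /I/= in_itv/= => xI.
  apply: (@continuous_comp _ _ _ (fun x => x - c) (@tan R)).
    by apply: cvgB; [exact: cvg_id|exact: cvg_cst].
  apply: continuous_tan; rewrite gt_eqF// cos_gt0_pihalf//.
  by move: xI; lra.
have nuitv (a b : R) : a < b -> nu `]a, b]%classic = (atan b - atan a)%:E.
  move=> ab; rewrite nuE//.
  rewrite integral_itv_obnd_cbnd; last first.
    by apply/measurable_EFinP; exact: measurable_funS mw.
  rewrite (@continuous_FTC2 _ _ (@atan R))//.
  - exact: continuous_subspaceT.
  - split => [x _||].
    + exact: derivable_atan.
    + by apply: cvg_at_right_filter; exact: continuous_atan.
    + by apply: cvg_at_left_filter; exact: continuous_atan.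
  - by move=> x _; rewrite derive1_atan.
have tanI (x : R) : c - pi / 2 < x < c + pi / 2 -> atan (tan (x - c)) = x - c.
  by move=> xI; rewrite tanK// in_itv/=; move: xI; lra.
pose nu1 := image_measure (mrestr mu mI) mpsi.
have nu1itv (a b : R) : a < b -> nu1 `]a, b]%classic = (atan b - atan a)%:E.
  move=> ab; rewrite /nu1/= /pushforward /mrestr.
  (* On [I] the increasing function [atan] inverts [tan (. - c)], so the preimage of an interval is
     again an interval. *)
  rewrite (_ : _ `&` _ = `](c + atan a), (c + atan b)]%classic); last first.
    apply/seteqP; split => x /=; rewrite /I /psi /= !in_itv/= patchE.
      move=> [+ xI]; rewrite mem_set; last by rewrite /I/= in_itv.
      move=> /andP[ax xb]; have := tanI _ xI; have := lt_atan ax; have := le_atan xb.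
      by lra.
    move=> xab; have xI : c - pi / 2 < x < c + pi / 2.
      by have := atan_gtNpi2 a; have := atan_ltpi2 b; move: xab; lra.
    split => //; rewrite mem_set; last by rewrite /I/= in_itv.
    have := tanI _ xI; move: (tan _) => t xt; apply/andP; split.
      by rewrite ltNge; apply/negP => /le_atan; move: xab; lra.
    by rewrite leNgt; apply/negP => /lt_atan; move: xab; lra.
  have L : lebesgue_measure `](c + atan a), (c + atan b)]%classic =
      (atan b - atan a)%:E :> \bar R.
    rewrite lebesgue_measure_itv/= lte_fin ltrD2l lt_atan// -EFinD.
    by congr EFin; ring.
  exact: L.
have E A : measurable A -> nu A = nu1 A.
  move=> mA; transitivity (lebesgue_stieltjes_measure (@atan R) A).
    apply/esym; apply: lebesgue_stieltjes_measure_unique mA => X /ocitvP[->|[[a b] /= ab ->]].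
      by rewrite !measure0.
    by rewrite stieltjes_atan 1?ltW// nuitv.
  apply: lebesgue_stieltjes_measure_unique mA => X /ocitvP[->|[[a b] /= ab ->]].
    by rewrite !measure0.
  by rewrite stieltjes_atan 1?ltW// nu1itv.
have mGa : measurable_fun [set: measurableTypeR R] (fun t => G (c + atan t)).
  apply: measurableT_comp => //.
  apply: measurable_funD => //.
  by apply: (@continuous_measurable_fun R); exact: continuous_atan.
rewrite -nuI//.
rewrite (@eq_measure_integral _ (measurableTypeR R) R setT nu1 nu); last by move=> A mA _; exact: E.
rewrite (ge0_integral_pushforward mpsi)//.
rewrite preimage_setT integral_mrestr; last 2 first.
- exact: (measurableT_comp mGa mpsi).
- by move=> x; exact: G0.
apply: eq_integral => x; rewrite inE => xI /=.
rewrite /psi patchE mem_set// tanK; first by congr G; ring.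
by move: xI; rewrite /= !in_itv/=; lra.
Qed.

(** * Polar coordinates *)

Section ray_integral.
Context {R : realType}.
Local Notation mu := (@lebesgue_measure R).
Local Notation RR := (measurableTypeR R * measurableTypeR R)%type.
Variable F : RR -> \bar R.
Hypothesis mF : measurable_fun [set: RR] F.
Hypothesis F0 : forall z, (0 <= F z)%E.

(* [Num.max r 0] restricts the integral to the half-line [r > 0]. *)
Definition ray_integral (th : R) : \bar R :=
  (\int[mu]_r ((Num.max r 0)%:E * F (r * cos th, r * sin th)%R))%E.

Let max_ge0 (r : R) : (0 <= (Num.max r 0)%:E)%E.
Proof. by rewrite lee_fin le_max lexx orbT. Qed.

Let measurable_FM d (T : measurableType d) (X Y Z : T -> R) :
  measurable_fun [set: T] X -> measurable_fun [set: T] Y ->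
  measurable_fun [set: T] Z ->
  measurable_fun [set: T] (fun z => (Num.max (Z z) 0)%:E * F (X z, Y z))%E.
Proof.
move=> mX mY mZ; apply: emeasurable_funM.
  by apply/measurable_EFinP; apply: measurable_maxr.
apply: (measurableT_comp mF).
exact: measurable_fun_pair.
Qed.

Let mfst : measurable_fun [set: RR] (fun z : RR => z.1 : R).
Proof. exact: measurable_fst. Qed.
Let msnd : measurable_fun [set: RR] (fun z : RR => z.2 : R).
Proof. exact: measurable_snd. Qed.

Let mcos : measurable_fun [set: R] (@cos R).
Proof. by apply: continuous_measurable_fun; exact: continuous_cos. Qed.
Let msin : measurable_fun [set: R] (@sin R).
Proof. by apply: continuous_measurable_fun; exact: continuous_sin. Qed.

Lemma ray_integral_ge0 th : (0 <= ray_integral th)%E.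
Proof. by apply: integral_ge0 => r _; exact: mule_ge0. Qed.

(** The integrand is jointly measurable in angle and radius, so Tonelli's theorem makes its partial
    integral measurable. *)
Lemma measurable_ray_integral : measurable_fun [set: R] ray_integral.
Proof.
pose H (z : RR) := ((Num.max (z.2:R) 0)%:E * F ((z.2:R) * cos z.1, (z.2:R) * sin z.1)%R)%E.
apply: (@measurable_fun_fubini_tonelli_F _ _ (measurableTypeR R) (measurableTypeR R) R mu H).
- apply: measurable_FM => //; apply: measurable_funM => //.
  + exact: (measurableT_comp mcos).
  + exact: (measurableT_comp msin).
- by move=> z; exact: mule_ge0.
Qed.

(** With [k = cos (atan t)], the direction of angle [pi / 2 + atan t] is [(- k t, k)]. Substituting
    [y = k r] yields one factor [k] from [dy] and one from the weight [y], and [k ^+ 2] is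
    [(1 + t ^+ 2)^-1]. *)
Lemma ray_integral_atan (t : R) :
  (((1 + t ^+ 2)^-1)%:E * ray_integral (pi / 2 + atan t) =
   \int[mu]_y ((Num.max y 0)%:E * F (- (y * t), y)%R))%E.
Proof.
pose k := cos (atan t).
have k0 : 0 < k by rewrite cos_gt0_pihalf// atan_gtNpi2 atan_ltpi2.
have kt : sin (atan t) = k * t by rewrite -{2}(atanK t) /tan mulrC divfK// gt_eqF.
have k2 : k ^+ 2 = (1 + t ^+ 2)^-1.
  by rewrite /k cos_atan exprVn sqr_sqrtr// addr_ge0// sqr_ge0.
rewrite (@ge0_integral_scale _ k); last 3 first.
- by rewrite gt_eqF.
- apply: measurable_FM => //; apply: measurableT_comp => //.
  exact: measurable_funM.
- by move=> y; exact: mule_ge0.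
rewrite -k2 gtr0_norm// expr2 EFinM -muleA; congr (_ * _)%E.
rewrite -ge0_integralZl//; last 3 first.
- by apply: measurable_FM => //; exact: measurable_funM.
- by move=> y _; exact: mule_ge0.
- by rewrite lee_fin ltW.
apply: eq_integral => r _.
rewrite muleA -EFinM maxr_pMr ?(ltW k0)// mulr0.
congr (_ * F (_, _))%E.
- by rewrite addrC cosDpihalf kt; ring.
- by rewrite addrC sinDpihalf -/k mulrC.
Qed.

(** At height [y > 0] the substitution [x = - y t] has Jacobian [y]. Exchanging the integrals in [y]
    and [t] then leaves, for each slope [t], the integral computed in [ray_integral_atan]. *)
Lemma integral_upper_half :
  (\int[mu]_(y in `]0%R, +oo[) \int[mu]_x F (x, y) =
   \int[mu]_t (((1 + t ^+ 2)^-1)%:E * ray_integral (pi / 2 + atan t)))%E.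
Proof.
under [RHS]eq_integral do rewrite ray_integral_atan.
pose H (z : RR) := ((Num.max (z.1:R) 0)%:E * F (- ((z.1:R) * z.2), z.1)%R)%E.
rewrite -(@fubini_tonelli _ _ (measurableTypeR R) (measurableTypeR R) R mu mu H); last 2 first.
- apply: measurable_FM => //; apply: measurableT_comp => //; exact: measurable_funM.
- by move=> z; exact: mule_ge0.
rewrite integral_mkcond; apply: eq_integral => y _.
rewrite /H patchE; case: ifPn => [|]; rewrite ?notin_setE ?inE/= in_itv/= andbT => y0.
  rewrite (@ge0_integral_scale _ (- y)) ?oppr_eq0 ?gt_eqF//.
  + rewrite -ge0_integralZl//.
    rewrite normrN gtr0_norm//; apply: eq_integral => t _; rewrite max_l ?ltW// mulNr//.
    apply: (measurableT_comp mF); exact: measurable_fun_pair.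
  + by apply: (measurableT_comp mF); exact: measurable_fun_pair.
rewrite integral0_eq// => t _ /=; rewrite max_r ?mul0e//.
by rewrite leNgt; apply/negP.
Qed.

End ray_integral.

Section polar_coordinates.
Context {R : realType}.
Local Notation mu := (@lebesgue_measure R).
Local Notation RR := (measurableTypeR R * measurableTypeR R)%type.
Variable F : RR -> \bar R.
Hypothesis mF : measurable_fun [set: RR] F.
Hypothesis F0 : forall z, (0 <= F z)%E.

Let mH : measurable_fun [set: measurableTypeR R] (fun y => \int[mu]_x F (x, y))%E.
Proof.
exact: (@measurable_fun_fubini_tonelli_G
  _ _ (measurableTypeR R) (measurableTypeR R) R mu F).
Qed.

Let H0 (y : R) : (0 <= \int[mu]_x F (x, y))%E.
Proof. exact: integral_ge0. Qed.

(** The symmetry [z -> - z] reduces this to the upper half-plane and adds [pi] to every angle. *)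
Lemma integral_lower_half :
  (\int[mu]_(y in `]-oo, 0%R[) \int[mu]_x F (x, y) =
   \int[mu]_t (((1 + t ^+ 2)^-1)%:E * ray_integral F (3 * pi / 2 + atan t)))%E.
Proof.
pose N (z : RR) : RR := (- (z.1 : R), - (z.2 : R)).
have mN : measurable_fun [set: RR] N.
  by apply: measurable_fun_pair; apply: measurableT_comp => //.
transitivity (\int[mu]_(y in `]0%R, +oo[) \int[mu]_x (F \o N) (x, y))%E.
  rewrite integral_mkcond [RHS]integral_mkcond (@ge0_integral_scale _ (-1)); last 3 first.
  - by rewrite oppr_eq0 oner_eq0.
  - by apply/(measurable_restrictT _ (measurable_itv _)); exact: measurable_funTS.
  - by move=> y; rewrite patchE; case: ifPn.
  rewrite normrN1 mul1e; apply: eq_integral => y _.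
  rewrite !patchE !mulN1r.
  rewrite (_ : (- y \in _) = (y \in `]0%R, +oo[%classic)); last first.
    by apply/idP/idP; rewrite !inE/= !in_itv/= andbT oppr_lt0.
  case: ifPn => // y0.
  rewrite (@ge0_integral_scale _ (-1)) ?oppr_eq0 ?oner_eq0//.
    by rewrite normrN1 mul1e; apply: eq_integral => x _; rewrite mulN1r.
  by apply: (measurableT_comp mF); exact: measurable_fun_pair.
rewrite (@integral_upper_half _ (F \o N)); last 2 first.
- exact: (measurableT_comp mF mN).
- by move=> z; exact: F0.
apply: eq_integral => t _; congr (_ * _)%E; apply: eq_integral => r _.
congr (_ * F (_, _))%E.
all: rewrite (_ : 3 * pi / 2 + atan t = pi / 2 + atan t + pi); last by field.
  by rewrite cosDpi mulrN.
by rewrite sinDpi mulrN.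
Qed.

Lemma polar_coordinates :
  (\int[mu \x mu]_z F z = \int[mu]_(th in `[0%R, (2 * pi)%R]) ray_integral F th)%E.
Proof.
have mray : measurable_fun [set: measurableTypeR R] (ray_integral F).
  exact: measurable_ray_integral.
rewrite (@fubini_tonelli2 _ _ (measurableTypeR R) (measurableTypeR R) R mu mu F)// /fubini_G.
pose h y := (\int[mu]_x F (x, y))%E.
rewrite -[LHS]/(\int[mu]_y h y)%E.
rewrite -(setUv (`]-oo, 0%R[%classic : set R)) ge0_integral_setU//; last 4 first.
- exact: measurableC.
- by rewrite setUv.
- by move=> x _; exact: H0.
- exact/disj_setPCl.
(* The height [y = 0] is negligible, so the closed half-line may be replaced by the open one. *)
rewrite setCitvl -integral_itv_obnd_cbnd; last exact: measurable_funTS.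
rewrite integral_lower_half integral_upper_half//.
(* The centres [pi / 2] and [3 * pi / 2] give the windows []0, pi[] and []pi, 2 pi[], which fill
   [[0, 2 pi]] up to three points. *)
rewrite -!ge0_integral_atan//; try by move=> x; exact: ray_integral_ge0.
have pi0 : 0 < pi :> R := pi_gt0 R.
have -> : 3 * pi / 2 - pi / 2 = pi :> R by field.
have -> : 3 * pi / 2 + pi / 2 = 2 * pi :> R by field.
have -> : pi / 2 - pi / 2 = 0 :> R by field.
have -> : pi / 2 + pi / 2 = pi :> R by field.
rewrite [in RHS](@itv_bndbnd_setU _ _ _ (BLeft (pi : R))); last 2 first.
- by rewrite bnd_simp; exact: ltW.
- by rewrite bnd_simp; move: pi0; lra.
rewrite ge0_integral_setU//; last 3 first.
- exact: measurable_funTS.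
- by move=> x _; exact: ray_integral_ge0.
- apply/disj_setPS => x []/=; rewrite !in_itv/= => /andP[_ +] /andP[+ _].
  by move=> /lt_le_trans h1 /h1; rewrite ltxx.
rewrite addeC; congr (_ + _)%E; apply/esym/integral_itv_bndoo; exact: measurable_funTS.
Qed.
End polar_coordinates.

(** * Subgradients and directional derivatives *)

(** The angle is [acos (a / rho)], with the sign of [b]; at the origin the angle 0 is chosen. *)
Lemma polar_representation (R : realType) (a b : R) :
  exists rho th : R, [/\ rho = Num.sqrt (a ^+ 2 + b ^+ 2),
    a = rho * cos th & b = rho * sin th].
Proof.
pose rho := Num.sqrt (a ^+ 2 + b ^+ 2).
have [ab0|ab0] := eqVneq (a ^+ 2 + b ^+ 2) 0.
  exists 0, 0; rewrite ab0 sqrtr0 !mul0r; move/eqP: ab0.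
  by rewrite paddr_eq0 ?sqr_ge0// !sqrf_eq0 => /andP[/eqP-> /eqP->].
have rho2 : rho ^+ 2 = a ^+ 2 + b ^+ 2 by rewrite sqr_sqrtr// addr_ge0// sqr_ge0.
have rho0 : 0 < rho by rewrite sqrtr_gt0 lt_neqAle eq_sym ab0 addr_ge0// sqr_ge0.
have arho : - 1 <= a / rho <= 1.
  rewrite -ler_norml normrM normfV (gtr0_norm rho0) ler_pdivrMr// mul1r.
  by rewrite -ler_sqr ?nnegrE ?(ltW rho0)// real_normK ?num_real// rho2 lerDl sqr_ge0.
have sE : rho * Num.sqrt (1 - (a / rho) ^+ 2) = `|b|.
  rewrite -{1}(ger0_norm (ltW rho0)) -sqrtr_sqr -sqrtrM ?sqr_ge0// -[RHS]sqrtr_sqr.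
  congr Num.sqrt; rewrite mulrBr mulr1 exprMn exprVn mulrCA divff ?mulr1 ?rho2.
    by rewrite addrC addKr.
  by rewrite ab0.
have aE : a = rho * cos (acos (a / rho)).
  by rewrite acosK ?in_itv//= mulrC divfK// gt_eqF.
have [b0|b0] := lerP 0 b.
  exists rho, (acos (a / rho)); split => //.
  by rewrite sin_acos// sE ger0_norm.
exists rho, (- acos (a / rho)); split => //; first by rewrite cosN.
by rewrite sinN sin_acos// mulrN sE ltr0_norm// opprK.
Qed.

(** The angle [phi] is reduced modulo [2 pi] into the window over which [Rplus] and [Rminus] are
    taken: [th + asin (sin (phi - th))] works because a positive cosine is determined by the
    sine. *)
Lemma cos_gt0_representation (R : realType) (th phi : R) : 0 < cos (th - phi) ->
  exists th', [/\ th' \in `](th - pi / 2), (th + pi / 2)[,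
    cos th' = cos phi & sin th' = sin phi].
Proof.
rewrite -cosN opprB => c0; set s := sin (phi - th); set c := cos (phi - th) in c0.
have cs : c ^+ 2 + s ^+ 2 = 1 by exact: cos2Dsin2.
have s1 : - 1 < s < 1.
  rewrite -ltr_norml -(@ltr_pXn2r _ 2)// ?nnegrE// real_normK ?num_real// expr1n -cs.
  by rewrite ltrDr exprn_gt0.
have /andP[s1l s1r] := s1.
exists (th + asin s); split.
- have := @asin_ltpi2 R s; have := @asin_gtNpi2 R s.
  rewrite in_itv/= s1l s1r !ltW// => /(_ isT) ? /(_ isT) ?.
  by apply/andP; split; lra.
- have -> : phi = th + (phi - th) by ring.
  rewrite (cosD th (asin s)) (cosD th (phi - th)) -/s -/c.
  by rewrite cos_asin ?asinK ?in_itv/= ?ltW// -cs addrK sqrtr_sqr gtr0_norm.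
- have -> : phi = th + (phi - th) by ring.
  rewrite (sinD th (asin s)) (sinD th (phi - th)) -/s -/c.
  by rewrite cos_asin ?asinK ?in_itv/= ?ltW// -cs addrK sqrtr_sqr gtr0_norm.
Qed.

Section dirder.
Context {R : realType} (O : set (R * R)) (u : R * R -> R) (x : R * R).
Hypotheses (hOopen : open O) (hOconv : convex_set2 O) (hu : convex_on2 O u) (hx : O x).

Definition shift (r th : R) : R * R := (x.1 + r * cos th, x.2 + r * sin th).
Definition diffq (th r : R) : R := (u (shift r th) - u x) / r.

Let near_dom : exists2 d : R, 0 < d & forall r th, `|r| < d -> O (shift r th).
Proof.
have /nbhs_ballP[d /= d0 dO] : nbhs x O by exact: open_nbhs_nbhs.
exists d => // r th rd; apply: dO; split; rewrite /ball/= opprD addrA subrr sub0r normrN normrM.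
  by rewrite (le_lt_trans _ rd)// ler_piMr// ler_norml cos_geN1 cos_le1.
by rewrite (le_lt_trans _ rd)// ler_piMr// ler_norml sin_geN1 sin_le1.
Qed.

(** Convexity is applied to the point at ratio [r / s] on the segment from [x] to [shift s th]. *)
Lemma diffq_le r s th : 0 < r -> r <= s -> O (shift s th) -> diffq th r <= diffq th s.
Proof.
move=> r0 rs Os; have s0 : 0 < s := lt_le_trans r0 rs.
have t0 : 0 <= r / s by rewrite divr_ge0// ltW.
have t1 : r / s <= 1 by rewrite ler_pdivrMr// mul1r.
have := hu hx Os t0 t1.
have -> : ((1 - r / s) * x.1 + r / s * (shift s th).1,
           (1 - r / s) * x.2 + r / s * (shift s th).2) = shift r th.
  by rewrite /shift/=; congr pair; field; rewrite gt_eqF.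
rewrite /diffq => H; rewrite ler_pdivrMr//.
have -> : (u (shift s th) - u x) / s * r = (1 - r / s) * u x + r / s * u (shift s th) - u x by ring.
by rewrite lerB.
Qed.

(** The point [x] lies between [shift (- s) th] and [shift r th], so a backward slope bounds the
    forward slopes from below; this keeps the directional derivative finite. *)
Lemma diffq_ge r s th : 0 < r -> 0 < s -> O (shift r th) -> O (shift (- s) th) ->
  (u x - u (shift (- s) th)) / s <= diffq th r.
Proof.
move=> r0 s0 Or Os.
have rs : 0 < s + r by rewrite addr_gt0.
have t0 : 0 <= s / (s + r) by rewrite divr_ge0// ltW.
have t1 : s / (s + r) <= 1 by rewrite ler_pdivrMr// mul1r lerDl ltW.
have := hu Os Or t0 t1.
have -> : ((1 - s / (s + r)) * (shift (- s) th).1 + s / (s + r) * (shift r th).1,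
  (1 - s / (s + r)) * (shift (- s) th).2 + s / (s + r) * (shift r th).2) = x.
  rewrite [RHS]surjective_pairing /shift/=; congr pair; field; rewrite gt_eqF//.
have -> : (1 - s / (s + r)) * u (shift (- s) th) + s / (s + r) * u (shift r th) =
  (r * u (shift (- s) th) + s * u (shift r th)) / (s + r).
  by field; rewrite gt_eqF.
rewrite ler_pdivlMr// => H.
rewrite /diffq ler_pdivrMr// mulrAC ler_pdivlMr//.
lra.
Qed.

(** The slopes are monotone and bounded below, so the limit defining [dirder] exists and is their
    infimum. The radius [d] is the same for all directions. *)
Let dirder_inf : exists2 d : R, 0 < d & (forall r th, `|r| < d -> O (shift r th)) /\
  forall th, has_inf (diffq th @` `]0, d[) /\ dirder u x th = inf (diffq th @` `]0, d[).
Proof.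
have [d d0 dO] := near_dom; exists d => //; split => // th.
have lb : has_lbound (diffq th @` `]0, d[).
  exists ((u x - u (shift (- (d / 2)) th)) / (d / 2)) => _ [r /= + <-].
  rewrite in_itv/= => /andP[r0 rd]; apply: diffq_ge => //; first by lra.
    by apply: dO; rewrite gtr0_norm.
  by apply: dO; rewrite normrN gtr0_norm; lra.
split.
  split => //; exists (diffq th (d / 2)); exists (d / 2) => //=.
  by rewrite in_itv/=; apply/andP; split; lra.
apply: cvg_lim; first exact: Rhausdorff.
apply: (@nondecreasing_at_right_cvgr R (diffq th) 0 (BLeft d)) => //.
move=> r s; rewrite !in_itv/= => /andP[r0 rd] /andP[s0 sd] rs.
by apply: diffq_le => //; apply: dO; rewrite gtr0_norm.
Qed.

Lemma dirder_le_diffq th r : 0 < r -> O (shift r th) -> dirder u x th <= diffq th r.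
Proof.
move=> r0 Or; have [d d0 [dO /(_ th)[[_ lb] ->]]] := dirder_inf.
(* The infimum only runs over radii below [d], and [r] may be larger; monotonicity bridges the
   gap. *)
pose r' := Num.min r (d / 2).
have r'0 : 0 < r' by rewrite lt_min r0/=; lra.
apply: (@le_trans _ _ (diffq th r')).
  apply: ge_inf => //; exists r' => //=; rewrite in_itv/= r'0/=.
  by rewrite gt_min; apply/orP; right; lra.
by apply: diffq_le => //; rewrite ge_min lexx.
Qed.

Lemma diffq_le_dirder th e : 0 < e -> exists2 d, 0 < d &
  forall r, 0 < r < d -> O (shift r th) /\ diffq th r <= dirder u x th + e.
Proof.
move=> e0; have [d d0 [dO /(_ th)[hinf ->]]] := dirder_inf.
have [_ [s /= + <-] sE] := inf_adherent e0 hinf.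
rewrite in_itv/= => /andP[s0 sd]; exists s => // r /andP[r0 rs].
have Or t : 0 < t -> t <= s -> O (shift t th).
  by move=> t0 ts; apply: dO; rewrite gtr0_norm// (le_lt_trans ts).
split; first by apply: Or => //; exact: ltW.
by apply: (le_trans _ (ltW sE)); apply: diffq_le => //; [exact: ltW|exact: Or].
Qed.

(** For small [t], the point [shift (t * rho) th] is the midpoint of [shift (2 * t * a) phi] and
    [shift (2 * t * b) psi]. Convexity at the midpoint compares the three slopes, and these
    approximate the derivatives. *)
Lemma dirder_sublinear (rho a b th phi psi : R) : 0 < rho -> 0 < a -> 0 < b ->
  rho * cos th = a * cos phi + b * cos psi ->
  rho * sin th = a * sin phi + b * sin psi ->
  rho * dirder u x th <= a * dirder u x phi + b * dirder u x psi.
Proof.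
move=> rho0 a0 b0 Ec Es; apply/ler_addgt0Pr => e e0.
have ab0 : 0 < a + b by rewrite addr_gt0.
(* The slack [e / (a + b)] enters with weights [a] and [b], so the total error is [e]. *)
have [d1 d10 H1] := diffq_le_dirder phi (divr_gt0 e0 ab0).
have [d2 d20 H2] := diffq_le_dirder psi (divr_gt0 e0 ab0).
(* Division by 4 makes [2 * t * a] at most [d1 / 2] and [2 * t * b] at most [d2 / 2], hence strictly
   within the radii. *)
pose t := Num.min (d1 / a) (d2 / b) / 4.
have t0 : 0 < t by rewrite divr_gt0// lt_min !divr_gt0.
have ta : 2 * t * a < d1.
  rewrite -ltr_pdivlMr//; have : Num.min (d1 / a) (d2 / b) <= d1 / a by rewrite ge_min lexx.
  by have := divr_gt0 d10 a0; rewrite /t; lra.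
have tb : 2 * t * b < d2.
  rewrite -ltr_pdivlMr//; have : Num.min (d1 / a) (d2 / b) <= d2 / b by rewrite ge_min lexx orbT.
  by have := divr_gt0 d20 b0; rewrite /t; lra.
have ta0 : 0 < 2 * t * a by do 2?[apply: mulr_gt0 => //].
have tb0 : 0 < 2 * t * b by do 2?[apply: mulr_gt0 => //].
have [hO1 L1] := H1 (2 * t * a) (introT andP (conj ta0 ta)).
have [hO2 L2] := H2 (2 * t * b) (introT andP (conj tb0 tb)).
have half : 0 <= 2^-1 :> R /\ 2^-1 <= 1 :> R by split; lra.
have mid : ((1 - 2^-1) * (shift (2 * t * a) phi).1 + 2^-1 * (shift (2 * t * b) psi).1,
  (1 - 2^-1) * (shift (2 * t * a) phi).2 + 2^-1 * (shift (2 * t * b) psi).2)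
  = shift (t * rho) th.
  by rewrite /shift/= -!mulrA Ec Es; congr pair; field.
have hO3 := hOconv hO1 hO2 half.1 half.2; rewrite mid in hO3.
have := hu hO1 hO2 half.1 half.2; rewrite mid => L3.
have tr0 : 0 < t * rho by rewrite mulr_gt0.
have := dirder_le_diffq tr0 hO3; rewrite /diffq ler_pdivlMr// => L4.
move: L1 L2; rewrite /diffq !ler_pdivrMr// => L1 L2.
rewrite -(ler_pM2l t0).
have -> : e = a * (e / (a + b)) + b * (e / (a + b)) by field; rewrite gt_eqF.
nra.
Qed.

(** A subgradient bounds all slopes from below, hence their limit. Conversely, any [z] in [O] is
    written in polar coordinates around [x], and the slope towards [z] dominates the directional
    derivative. *)
Lemma subgradP p : subgrad O u x p <-> forall th, dot2 p (etheta th) <= dirder u x th.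
Proof.
split=> [pK th|pK z Oz].
  apply/ler_addgt0Pr => e e0; have [d d0 /(_ (d / 2))[|Od]] := diffq_le_dirder th e0.
    by apply/andP; split; lra.
  apply: le_trans; rewrite /diffq ler_pdivlMr; last by lra.
  have := pK _ Od; rewrite /dot2/= => H.
  by rewrite lerBrDl (le_trans _ H)//; rewrite le_eqVlt; apply/predU1P; left; ring.
have [rho [th [rhoE z1 z2]]] := polar_representation (z.1 - x.1) (z.2 - x.2).
have zE : z = shift rho th.
  by rewrite [LHS]surjective_pairing /shift -z1 -z2; congr pair; ring.
have rho0 : 0 <= rho by rewrite rhoE sqrtr_ge0.
rewrite z1 z2; have [r0|r0] := eqVneq rho 0.
  rewrite zE r0 /shift !mul0r !addr0 /dot2/= !mulr0 !addr0.
  by rewrite -surjective_pairing.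
have {}r0 : 0 < rho by rewrite lt_neqAle eq_sym r0.
have Or : O (shift rho th) by rewrite -zE.
have := le_trans (pK th) (dirder_le_diffq r0 Or).
rewrite /diffq ler_pdivlMr// -zE lerBrDl => H.
by apply: le_trans H; rewrite /dot2/=; rewrite le_eqVlt; apply/predU1P; left; ring.
Qed.

Lemma dirder_eq th th' : cos th = cos th' -> sin th = sin th' ->
  dirder u x th = dirder u x th'.
Proof. by rewrite /dirder => -> ->. Qed.

(* The directions orthogonal to [th] are reached from the open half-circle by sublinearity. *)
Lemma dirder_orthogonal_ge0 r th phi : 0 < r -> cos (th - phi) = 0 ->
  (forall th', 0 < cos (th - th') -> r * cos (th - th') <= dirder u x th') ->
  0 <= dirder u x phi.
Proof.
move=> r0 c0 H; rewrite leNgt; apply/negP => h0.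
pose hphi := dirder u x phi; pose hth := dirder u x th.
(* This size ensures [s * hth <= - hphi / 2], so that [hphi + s * hth] stays negative. *)
pose s := - hphi / (2 * (`|hth| + 1)).
have n0 : 0 <= `|hth| by [].
have s0 : 0 < s by rewrite divr_gt0 ?oppr_gt0// mulr_gt0// ltr_wpDl.
(* The direction orthogonal to [th] is tilted by [s] towards [th]; its inner product with the
   direction of [th] is then exactly [s > 0], so the hypothesis applies to [th']. *)
have [rho [th' [rhoE E1 E2]]] :=
  polar_representation (cos phi + s * cos th) (sin phi + s * sin th).
have dotE : rho * cos (th - th') = s.
  have -> : rho * cos (th - th') = cos th * (rho * cos th') + sin th * (rho * sin th').
    by rewrite cosB; ring.
  rewrite -E1 -E2.
  transitivity (cos (th - phi) + s * (cos th ^+ 2 + sin th ^+ 2)); first by rewrite cosB; ring.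
  by rewrite c0 cos2Dsin2 add0r mulr1.
have rho0 : 0 < rho.
  rewrite lt_neqAle rhoE sqrtr_ge0 andbT -rhoE; apply/eqP => r0'.
  by move: dotE; rewrite -r0' mul0r => s0'; move: s0; rewrite -s0' ltxx.
have cth' : 0 < cos (th - th') by rewrite -(pmulr_rgt0 _ rho0) dotE.
have sub := @dirder_sublinear rho 1 s th' phi th rho0 ltr01 s0.
have {}sub : rho * dirder u x th' <= hphi + s * hth.
  by have := sub; rewrite !mul1r; apply; rewrite -?E1 -?E2.
(* The left side is positive and the right side is at most [hphi / 2 < 0]: a contradiction. *)
have lo : r * s <= hphi + s * hth.
  apply: le_trans sub; rewrite -dotE mulrCA ler_pM2l//; exact: H.
have : s * hth <= - hphi / 2.
  apply: (@le_trans _ _ (s * (`|hth| + 1))).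
    by rewrite ler_pM2l// (le_trans (ler_norm _))// lerDl.
  by rewrite /s; rewrite le_eqVlt; apply/predU1P; left; field; rewrite gt_eqF// ltr_wpDl.
have : 0 < r * s by rewrite mulr_gt0.
have : hphi < 0 by [].
by clear -lo; lra.
Qed.

(** Each angle [th'] of the window gives an upper bound on [r], and its opposite [th' + pi] a lower
    bound. As [r > 0], truncating the derivatives at 0 preserves both conditions. *)
Lemma subgrad_rayP r th : 0 < r ->
  subgrad O u x (r * cos th, r * sin th) <->
  forall th', th' \in `](th - pi / 2), (th + pi / 2)[ ->
    r <= Num.max (dirder u x th') 0 / cos (th - th') /\
    Num.max (- dirder u x (th' + pi)) 0 / cos (th - th') <= r.
Proof.
move=> r0; rewrite subgradP.
have dotE phi : dot2 (r * cos th, r * sin th) (etheta phi) = r * cos (th - phi).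
  by rewrite /dot2/= cosB; ring.
have cI th' : th' \in `](th - pi / 2), (th + pi / 2)[ -> 0 < cos (th - th').
  by rewrite in_itv/= => /andP[? ?]; apply: cos_gt0_pihalf; apply/andP; split; lra.
split=> [H th' /cI c0|H].
  split.
    rewrite ler_pdivlMr//; apply: (@le_trans _ _ (dirder u x th')).
      by rewrite -dotE.
    by rewrite le_max lexx.
  rewrite ler_pdivrMr// ge_max; apply/andP; split; last by rewrite mulr_ge0// ltW.
  have cE : cos (th - (th' + pi)) = - cos (th - th').
    by rewrite opprD addrA cosB cospi sinpi; ring.
  by have := H (th' + pi); rewrite dotE cE mulrN lerNl.
have pos phi : 0 < cos (th - phi) -> r * cos (th - phi) <= dirder u x phi.
  move=> c0; have [th' [th'I Ec Es]] := cos_gt0_representation c0.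
  have [+ _] := H _ th'I.
  have Ecos : cos (th - th') = cos (th - phi) by rewrite !cosB Ec Es.
  rewrite Ecos (dirder_eq Ec Es) ler_pdivlMr// le_max => /orP[//|].
  by rewrite leNgt mulr_gt0.
move=> phi; rewrite dotE; have [c0|c0|c0] := ltgtP (cos (th - phi)) 0.
(* The opposite angle [phi + pi] is moved to [th'] in the window, and [th' + pi] then has the
   direction of [phi]. *)
- have : 0 < cos (th - (phi + pi)).
    by rewrite opprD addrA cosB cospi sinpi mulr0 addr0 mulrN1 oppr_gt0.
  move=> /cos_gt0_representation[th' [th'I]]; rewrite cosDpi sinDpi => Ec Es.
  have [_] := H _ th'I.
  have Ecos : cos (th - th') = - cos (th - phi).
    by rewrite !cosB Ec Es; ring.
  rewrite Ecos (@dirder_eq (th' + pi) phi); last 2 first.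
  - by rewrite cosDpi Ec opprK.
  - by rewrite sinDpi Es opprK.
  rewrite ler_pdivrMr ?oppr_gt0// ge_max => /andP[+ _].
  by rewrite mulrN lerN2.
- exact: pos.
- by rewrite c0 mulr0; apply: (dirder_orthogonal_ge0 r0 c0).
Qed.

Lemma subgrad_ray_RpmP r th : 0 < r ->
  subgrad O u x (r * cos th, r * sin th) <->
  (Rminus u x th <= r%:E)%E /\ (r%:E <= Rplus u x th)%E.
Proof.
move=> r0; rewrite subgrad_rayP//; split=> [H|[H1 H2] th' th'I].
  split.
    by apply: ge_ereal_sup => _ [th' /= th'I <-]; rewrite lee_fin; exact: (H _ th'I).2.
  by apply: le_ereal_inf_tmp => _ [th' /= th'I <-]; rewrite lee_fin; exact: (H _ th'I).1.
split; rewrite -lee_fin.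
  by apply: (le_trans H2); apply: ereal_inf_lbound; exists th'.
by apply: le_trans H1; apply: ereal_sup_ubound; exists th'.
Qed.

End dirder.

(** * Measurability of the subgradient *)

Lemma open_measurable_prod (R : realType) (A : set (R * R)) :
  open A -> measurable (A : set (measurableTypeR R * measurableTypeR R)).
Proof.
move=> oA.
pose B (q : (rat * rat) * (rat * rat)) : set (measurableTypeR R * measurableTypeR R) :=
  `]ratr q.1.1, ratr q.1.2[%classic `*` `]ratr q.2.1, ratr q.2.2[%classic.
(* An open set is the union of the boxes with rational corners that it contains, and these are
   countably many. *)
have -> : A = \bigcup_(q in [set q | B q `<=` A]) B q.
  apply/seteqP; split => [p Ap|p [q /= qA]]; last exact: qA.
  have /nbhs_ballP[e /= e0 eA] : nbhs p A by exact: open_nbhs_nbhs.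
  have I (y : R) : exists ab : rat * rat, y - e < ratr ab.1 < y /\ y < ratr ab.2 < y + e.
    have [a] : exists q : rat, ratr q \in `](y - e), y[ by apply: rat_in_itvoo; lra.
    have [b] : exists q : rat, ratr q \in `]y, (y + e)[ by apply: rat_in_itvoo; lra.
    by rewrite !in_itv/= => ? ?; exists (a, b).
  have [q1 [/andP[a1 a2] /andP[b1 b2]]] := I p.1.
  have [q2 [/andP[c1 c2] /andP[d1 d2]]] := I p.2.
  exists (q1, q2); rewrite /B/=; last by split; rewrite /= in_itv/=; apply/andP; split.
  move=> z [] /=; rewrite !in_itv/= => /andP[z1 z2] /andP[z3 z4].
  by apply: eA; split; rewrite /ball/= ltr_norml; apply/andP; split; lra.
rewrite bigcup_mkcond; apply: countable_bigcupT_measurable; first exact: countableP.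
by move=> q; case: ifP => // _; apply: measurableX; exact: measurable_itv.
Qed.

(** Each [z] in [O] imposes an affine inequality on [p], so this is an intersection of closed
    sets. *)
Lemma closed_subgrad (R : realType) (O : set (R * R)) (u : R * R -> R) (x : R * R) :
  closed (subgrad O u x).
Proof.
have -> : subgrad O u x = \bigcap_(z in O)
    (fun p => u x + dot2 p (z.1 - x.1, z.2 - x.2)) @^-1` [set t | t <= u z].
  by apply/seteqP; split => p pK z Oz; exact: pK.
apply: closed_bigI => z _.
apply: closed_comp; last exact: closed_le.
move=> p _; apply: cvgD; first exact: cvg_cst.
by apply: cvgD; apply: cvgM; (exact: cvg_cst || exact: cvg_fst || exact: cvg_snd).
Qed.

Lemma measurable_subgrad (R : realType) (O : set (R * R)) (u : R * R -> R) (x : R * R) :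
  measurable (subgrad O u x : set (measurableTypeR R * measurableTypeR R)).
Proof.
rewrite -(setCK (subgrad O u x)); apply: measurableC.
by apply: open_measurable_prod; apply: closed_openC; exact: closed_subgrad.
Qed.

(** * Integration along a ray and the area formula *)

Lemma integral_idfun (R : realType) (a b : R) : a <= b ->
  (\int[@lebesgue_measure R]_(r in `[a, b]) r%:E = ((b ^+ 2 - a ^+ 2) / 2)%:E)%E.
Proof.
rewrite le_eqVlt => /predU1P[->|ab].
  by rewrite set_itv1 integral_set1 subrr mul0r.
pose F (r : R) : R := r ^+ 2 / 2.
have dF (y : R) : is_derive y 1 F y.
  have -> : F = 2^-1 \*: (fun r => r ^+ 2) by apply/funext => r; rewrite /F mulrC.
  by apply: is_derive_eq; rewrite /GRing.scale/=; field.
have cF (y : R) : {for y, continuous F}.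
  by apply: differentiable_continuous; apply/derivable1_diffP.
rewrite (@continuous_FTC2 _ id F)//.
- by rewrite -EFinD /F; congr EFin; ring.
- by apply: continuous_subspaceT => y; exact: cvg_id.
- split => [y _||]; first exact: ex_derive.
  + by apply: cvg_at_right_filter; exact: cF.
  + by apply: cvg_at_left_filter; exact: cF.
- by move=> y _; rewrite derive1E derive_val.
Qed.

Section area.
Context {R : realType} (O : set (R * R)) (u : R * R -> R) (x : R * R).
Hypotheses (hOopen : open O) (hOconv : convex_set2 O) (hu : convex_on2 O u) (hx : O x).
Local Notation mu := (@lebesgue_measure R).

Lemma Rplus_ge0 th : (0 <= Rplus u x th)%E.
Proof.
apply: le_ereal_inf_tmp => _ [th' /= + <-]; rewrite in_itv/= => /andP[? ?].
rewrite lee_fin divr_ge0//; first by rewrite le_max lexx orbT.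
by apply/ltW/cos_gt0_pihalf; apply/andP; split; lra.
Qed.

Let th_itv (th : R) : th \in `](th - pi / 2), (th + pi / 2)[.
Proof. by rewrite in_itv/=; have := pi_gt0 R => ?; apply/andP; split; lra. Qed.

(** The choice [th' = th] bounds the infimum by a real number. Hence the difference of squares in
    [area_integrand] never has the form [+oo - +oo]. *)
Lemma Rplus_fin_num th : Rplus u x th \is a fin_num.
Proof.
rewrite ge0_fin_numE ?Rplus_ge0//.
apply: (@le_lt_trans _ _ (Num.max (dirder u x th) 0 / cos (th - th))%:E); last exact: ltry.
by apply: ereal_inf_lbound; exists th => //; exact: th_itv.
Qed.

Lemma Rminus_ge0 th : (0 <= Rminus u x th)%E.
Proof.
apply: (@le_trans _ _ (Num.max (- dirder u x (th + pi)) 0 / cos (th - th))%:E).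
  by rewrite lee_fin subrr cos0 divr1 le_max lexx orbT.
by apply: ereal_sup_ubound; exists th => //; exact: th_itv.
Qed.

Lemma ray_integral_subgrad th :
  ray_integral (fun z => (\1_(subgrad O u x) z)%:E) th = area_integrand u x th.
Proof.
have := Rplus_ge0 th; have := Rminus_ge0 th; have := Rplus_fin_num th.
have rayP r : 0 < r -> _ := @subgrad_ray_RpmP _ _ _ _ hOopen hOconv hu hx r th.
rewrite /area_integrand /ray_integral.
case: (Rplus u x th) rayP => [a||]// rayP _ b0; rewrite lee_fin => a0.
have off r : ((Num.max r 0)%:E * (\1_(subgrad O u x) (r * cos th, r * sin th))%:E =
   if (0 < r)%R && (Rminus u x th <= r%:E)%E && (r <= a)%R then r%:E else 0)%E.
  have [r0|r0] := ltrP 0 r; last by rewrite /= mul0e.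
  rewrite indicE; have [K|K] := pselect (subgrad O u x (r * cos th, r * sin th)).
    rewrite mem_set// mule1; have [-> H] := (rayP r r0).1 K.
    by rewrite -lee_fin H.
  rewrite memNset// mule0; case: ifP => // /andP[/= H1 H2]; exfalso; apply: K.
  by apply/(rayP r r0); rewrite lee_fin.
under eq_integral do rewrite off.
(* The value [-oo] is excluded by [b0]. For [+oo] no radius qualifies, and the maximum in
   [area_integrand] is 0 as well. *)
move: off => _; move: rayP => _; case: (Rminus u x th) b0 => [b||]// b0.
- have {}b0 : 0 <= b by rewrite -lee_fin.
  rewrite -EFinM -EFinM -EFinD.
  transitivity (\int[mu]_(r in `[b, a]) r%:E)%E.
    rewrite [RHS]integral_mkcond; apply: eq_integral => r _.
    rewrite patchE (_ : (r \in _) = (b <= r <= a)); last first.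
      by apply/idP/idP; rewrite inE/= in_itv.
    rewrite lee_fin; have [r0|r0] := ltrP 0 r => //=.
    (* Here [r <= 0] and [0 <= b <= r] force [r = 0], where both integrands vanish. *)
    case: ifP => // /andP[br ra]; congr EFin; apply/eqP.
    by rewrite eq_le r0 (le_trans b0).
  have [ba|ab] := leP b a.
    rewrite integral_idfun// max_l.
      by rewrite -EFinM; congr EFin; ring.
    by rewrite lee_fin subr_ge0 -!expr2 ler_pXn2r.
  rewrite set_itv_ge; last by rewrite bnd_simp -ltNge.
  by rewrite integral_set0 max_r ?mule0// lee_fin subr_le0 -!expr2 ler_pXn2r ?nnegrE// ltW//.
- rewrite mulyy/= max_r ?mule0//.
  by apply: integral0_eq => r _; rewrite andbF.
Qed.

End area.

Theorem theorem3p8 (R : realType) (O : set (R * R)) (u : R * R -> R)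
  (hOopen : open O) (hOconv : convex_set2 O) (hu : convex_on2 O u)
  (x : R * R) (hx : O x) :
  ((@lebesgue_measure R \x @lebesgue_measure R) (subgrad O u x)
   = \int[@lebesgue_measure R]_(th in `[0%R, (2 * pi)%R]) area_integrand u x th)%E.
Proof.
have mK := @measurable_subgrad R O u x.
under [RHS]eq_integral do rewrite -(ray_integral_subgrad hOopen hOconv hu hx).
rewrite -polar_coordinates; last 2 first.
- by apply/measurable_EFinP; exact: measurable_indic.
- by move=> z; rewrite lee_fin.
by rewrite integral_indic// setIT.
Qed.
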